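(* Let $A_1,\dots,A_k\in\mathbb R^{m\times n}$ be such that $\sum_{i=1}^k A_iA_i^\top$ and $\sum_{i=1}^k A_i^\top A_i$ are positive definite, and let $\omega>0$. Let $(X_t,Y_t)_{t\ge0}$ denote the iterates of the algorithm FPI-Geodesic-SOR (defined in the context) for the data $A_1,\dots,A_k$ and relaxation parameter $\omega$, initialized with $(X_0,Y_0)=(I_m,I_n)$. Let $(\bar L_t,\bar R_t,\bar A_{t,i})$ be the iterates of the algorithm OSI-Geodesic-SOR (defined in the context) for the same data $A_1,\dots,A_k$ and the same $\omega$. Define recursively \[ L_{t+1}=\bar L_{t+1}L_t,\qquad R_{t+1}=\bar R_{t+1}R_t,\qquad L_0=I_m,\quad R_0=I_n . \] Then for all $t\ge 0$ it holds that \[ \bar A_{t,i}=L_tA_iR_t^\top\qquad\text{for } i=1,\dots,k, \] and \[ X_t=L_t^\top L_t,\qquad Y_t=R_t^\top R_t . \]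
   Context: All matrices are real. Real powers $M^{s}$ ($s\in\mathbb R$) of a symmetric positive definite matrix $M$ are the symmetric positive definite matrices defined by the spectral functional calculus. For symmetric positive definite matrices $X,\tilde X$ of the same size and $\omega\in\mathbb R$, define \[ X\#_\omega\tilde X=X^{1/2}\bigl(X^{-1/2}\tilde XX^{-1/2}\bigr)^{\omega}X^{1/2}. \] Algorithm FPI-Geodesic-SOR. Input: matrices $A_1,\dots,A_k\in\mathbb R^{m\times n}$, symmetric positive definite matrices $X_0\in\mathbb R^{m\times m}$, $Y_0\in\mathbb R^{n\times n}$, and $\omega>0$. For $t=0,1,2,\dots$: (1) $X_{t+1}=X_t\#_\omega\Bigl[\frac1m\bigl(\sum_{i=1}^kA_iY_tA_i^\top\bigr)^{-1}\Bigr]$; (2) $Y_{t+1}=Y_t\#_\omega\Bigl[\frac1n\bigl(\sum_{i=1}^kA_i^\top X_{t+1}A_i\bigr)^{-1}\Bigr]$. Algorithm OSI-Geodesic-SOR. Input: matrices $A_1,\dots,A_k\in\mathbb R^{m\times n}$ and $\omega>0$; set $\bar A_{0,i}=A_i$ for $i=1,\dots,k$. For $t=0,1,2,\dots$: (1) $\bar L_{t+1}=m^{-\omega/2}\bigl(\sum_{i=1}^k\bar A_{t,i}\bar A_{t,i}^\top\bigr)^{-\omega/2}$; (2) $\bar R_{t+1}=n^{-\omega/2}\bigl(\sum_{i=1}^k\bar A_{t,i}^\top\bar L_{t+1}^\top\bar L_{t+1}\bar A_{t,i}\bigr)^{-\omega/2}$; (3) $\bar A_{t+1,i}=\bar L_{t+1}\bar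 A_{t,i}\bar R_{t+1}^\top$ for $i=1,\dots,k$. *)

(* Defs.v *)
From HB Require Import structures.
From mathcomp Require Import all_boot all_order all_algebra.
From mathcomp Require Import all_classical all_reals.
From mathcomp Require Import exp.

Set Implicit Arguments.
Unset Strict Implicit.
Unset Printing Implicit Defensive.

Import Order.TTheory GRing.Theory Num.Theory.

Local Open Scope classical_set_scope.
Local Open Scope ring_scope.

Definition posdefmx (R : realType) (p : nat) (M : 'M[R]_p) : Prop :=
  M^T = M /\ forall v : 'cV[R]_p, v != 0 -> 0 < (v^T *m M *m v) 0 0.

(* Spectral functional calculus: f(U diag(d) U^T) = U diag(f d) U^T with U
   orthogonal. The value does not depend on the chosen diagonalization, see
   [mxfunE]; it is 0 when M is not orthogonally diagonalizable, i.e., not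
   symmetric. *)
Definition mxfun (R : realType) (p : nat) (f : R -> R) (M : 'M[R]_p) : 'M[R]_p :=
  xget 0 [set P | exists (U : 'M[R]_p) (d : 'rV[R]_p),
    [/\ U *m U^T = 1%:M,
        M = U *m diag_mx d *m U^T &
        P = U *m diag_mx (map_mx f d) *m U^T]].

Lemma mxfunE (R : realType) (p : nat) (f : R -> R) (U : 'M[R]_p)
    (d : 'rV[R]_p) : U *m U^T = 1%:M ->
  mxfun f (U *m diag_mx d *m U^T) = U *m diag_mx (map_mx f d) *m U^T.
Proof.
move=> UU; rewrite /mxfun; case: xgetP => [_ -> [V [e [VV eqM ->]]]|]; last first.
  by move=> /(_ (U *m diag_mx (map_mx f d) *m U^T)) []; exists U, d.
have UU' := mulmx1C UU; have VV' := mulmx1C VV.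
set W := V^T *m U.
have WE (a b : 'rV[R]_p) :
    (V *m diag_mx b *m V^T = U *m diag_mx a *m U^T) <->
    (diag_mx b *m W = W *m diag_mx a).
  split=> E.
    have := congr1 (fun Z => V^T *m Z *m U) E; rewrite !mulmxA VV' mul1mx.
    by rewrite -(mulmxA _ U^T U) UU' mulmx1 -!mulmxA.
  have := congr1 (fun Z => V *m Z *m U^T) E; rewrite /W !mulmxA VV mul1mx.
  by rewrite -(mulmxA _ U U^T) UU mulmx1.
apply/WE; move/esym/WE: eqM => /matrixP E; apply/matrixP => i j.
move: (E i j); rewrite !mul_diag_mx !mul_mx_diag !mxE.
have [->|W0] := eqVneq (\sum_k V^T i k * U k j) 0; first by rewrite !(mul0r, mulr0).
by rewrite mulrC => /(mulfI W0) ->; rewrite mulrC.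
Qed.

(* The real power M^s; meaningful for symmetric positive definite M. *)
Definition mxpow (R : realType) (p : nat) (M : 'M[R]_p) (s : R) : 'M[R]_p :=
  mxfun (fun x => x `^ s) M.

Definition geodesic (R : realType) (p : nat) (X : 'M[R]_p) (omega : R)
    (X' : 'M[R]_p) : 'M[R]_p :=
  mxpow X 2^-1
    *m mxpow (mxpow X (- 2^-1) *m X' *m mxpow X (- 2^-1)) omega
    *m mxpow X 2^-1.

Definition FPI_Geodesic_SOR (R : realType) (m n k : nat)
    (A : 'I_k -> 'M[R]_(m, n)) (X0 : 'M[R]_m) (Y0 : 'M[R]_n) (omega : R)
    (X : nat -> 'M[R]_m) (Y : nat -> 'M[R]_n) : Prop :=
  [/\ X 0%N = X0, Y 0%N = Y0,
      forall t : nat, X t.+1 = geodesic (X t) omega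
        (m%:R^-1 *: invmx (\sum_(i < k) A i *m Y t *m (A i)^T)) &
      forall t : nat, Y t.+1 = geodesic (Y t) omega
        (n%:R^-1 *: invmx (\sum_(i < k) (A i)^T *m X t.+1 *m A i))].

(* barL and barR are only generated from index 1 on: barL 0 and barR 0 are
   left unconstrained. *)
Definition OSI_Geodesic_SOR (R : realType) (m n k : nat)
    (A : 'I_k -> 'M[R]_(m, n)) (omega : R)
    (barL : nat -> 'M[R]_m) (barR : nat -> 'M[R]_n)
    (barA : nat -> 'I_k -> 'M[R]_(m, n)) : Prop :=
  [/\ forall i : 'I_k, barA 0%N i = A i,
      forall t : nat, barL t.+1 = m%:R `^ (- (omega / 2)) *:
        mxpow (\sum_(i < k) barA t i *m (barA t i)^T) (- (omega / 2)),
      forall t : nat, barR t.+1 = n%:R `^ (- (omega / 2)) *: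
        mxpow (\sum_(i < k)
                 (barA t i)^T *m (barL t.+1)^T *m barL t.+1 *m barA t i)
              (- (omega / 2)) &
      forall (t : nat) (i : 'I_k),
        barA t.+1 i = barL t.+1 *m barA t i *m (barR t.+1)^T].

(* Main.v *)
Require Import Defs.
From mathcomp Require Import all_boot all_order all_algebra.
From mathcomp Require Import all_classical all_reals.
From mathcomp Require Import exp ring.
From mathcomp Require Import complex.

Set Implicit Arguments.
Unset Strict Implicit.
Unset Printing Implicit Defensive.

Import Order.TTheory GRing.Theory Num.Theory.

Local Open Scope ring_scope.

(** The geodesic [X #_w X'] is invariant under congruence.  If [X = L^T L] with
    [L] invertible, then [Q = L X^(-1/2)] is orthogonal and [L = Q X^(1/2)] (polar
    decomposition).  Since spectral powers commute with orthogonal conjugation,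
    [X #_w (L^T Z L) = L^T Z^w L] for every symmetric [Z] ([geodesic_congr]).

    One half-step of the fixed-point iteration has
    [X' = p^-1 S^-1 = L^T (p^-1 (L S L^T)^-1) L], hence its result is
    [L^T (p^-w (L S L^T)^-w) L = (L' L)^T (L' L)] with
    [L' = p^(-w/2) (L S L^T)^(-w/2)] ([geodesic_sor_step]).  When
    [X_t = L_t^T L_t], [Y_t = R_t^T R_t] and [barA_t = L_t A R_t^T], the matrix
    [L S L^T] of the first half-step is [sum barA_t barA_t^T], so that [L'] is
    exactly [barL_(t+1)]; the second half-step is the same with the roles of
    rows and columns exchanged.  An induction on [t] carries these three
    equalities along with the invertibility of [L_t] and [R_t], which keeps
    every matrix whose power is taken positive definite
    ([posdef_sum_mulr], [posdef_congr]).

    The laws of real powers are read off an orthogonal diagonalization, which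
    exists by the real spectral theorem ([real_spectral]).  That theorem is
    proved here by induction on the size: a real eigenvalue comes from the
    unitary diagonalization over [R[i]], and a Householder reflection completes
    a unit eigenvector to an orthogonal matrix, which splits off a block of
    size one. *)

(** * The spectral theorem for real symmetric matrices *)

Lemma normsq_ge0 (R : realDomainType) (n : nat) (u : 'rV[R]_n) :
  0 <= (u *m u^T) 0 0.
Proof. by rewrite mxE sumr_ge0 // => i _; rewrite mxE -expr2 sqr_ge0. Qed.

Lemma normsq_eq0 (R : realDomainType) (n : nat) (u : 'rV[R]_n) :
  ((u *m u^T) 0 0 == 0) = (u == 0).
Proof.
apply/eqP/eqP=> [|->]; last by rewrite mul0mx mxE.
rewrite mxE => /eqP; rewrite psumr_eq0 => [/allP z|i _]; last first.
  by rewrite mxE -expr2 sqr_ge0.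
apply/rowP => i; have := z i.
by rewrite mem_index_enum !mxE mulf_eq0 orbb => /(_ isT)/eqP.
Qed.

(** Over [R[i]] the matrix is hermitian, hence unitarily diagonalizable with a
    real diagonal; its characteristic polynomial has the same roots in [R]
    whichever field it is read over. *)
Lemma symmetric_eigenvalue (R : rcfType) (n : nat) (M : 'M[R]_n.+1) :
  M^T = M -> exists a, eigenvalue M a.
Proof.
move=> Msym; pose f := real_complex R.
have fMherm : map_mx f M \is hermsymmx.
  apply: realsym_hermsym; last first.
    by apply/mxOverP => i j; rewrite mxE /= complex_real.
  by apply/is_hermitianmxP; rewrite expr0 scale1r map_mx_id // map_trmx Msym.
have dreal := hermitian_spectral_diag_real fMherm.
have /orthomx_spectralP fME := hermitian_normalmx fMherm.
move: fME dreal; set P := spectralmx _; set d := spectral_diag _.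
move=> fME /mxOverP dreal.
have Punit : P \in unitmx by apply: spectral_unit.
have /complex_realP[a da] : d 0 0 \is Num.real by apply: dreal.
exists a; rewrite eigenvalue_root_char -(fmorph_root f) /= map_char_poly.
rewrite -eigenvalue_root_char.
apply/eigenvalueP; exists (row 0 P); last first.
  apply: contraTneq Punit => P0.
  rewrite unitmxE (expand_det_row _ 0) big1 ?unitr0 // => i _.
  by move/rowP/(_ i): P0; rewrite !mxE => ->; rewrite mul0r.
rewrite -row_mul fME !mulmxA mulmxV // mul1mx -da.
by apply/rowP => j; rewrite mul_diag_mx !mxE.
Qed.

(** The reflection exchanging [v] and the first basis vector [e], that is, the
    one along [w = v - e]; it exists as soon as [v] differs from [e]. *)
Lemma householder (R : realFieldType) (n : nat) (v : 'rV[R]_n.+1) :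
  v *m v^T = 1%:M -> exists2 Q : 'M[R]_n.+1, Q *m Q^T = 1%:M & row 0 Q = v.
Proof.
pose e : 'rV[R]_n.+1 := delta_mx 0 0 => vv.
have [->|ve] := eqVneq v e.
  by exists 1%:M; rewrite ?trmx1 ?mulmx1 // rowE mulmx1.
(* [c] is the squared norm of [w], computed from those of [v] and [e]. *)
pose w := v - e; pose c := 2 - 2 * v 0 0.
have ev : e *m v^T = (v 0 0)%:M.
  by rewrite -rowE; apply/matrixP => i j; rewrite !ord1 !mxE.
have ee : e *m e^T = 1%:M.
  by rewrite -rowE; apply/matrixP => i j; rewrite !ord1 !mxE.
have ewE : e *m w^T = (- (c / 2))%:M.
  rewrite linearB mulmxBr /= ev ee; apply/matrixP => i j.
  by rewrite !ord1 !mxE /c /=; field.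
have wwE : w *m w^T = c%:M.
  have ve' : v *m e^T = (v 0 0)%:M.
    by apply: trmx_inj; rewrite trmx_mul trmxK tr_scalar_mx.
  rewrite {1}/w mulmxBl ewE linearB mulmxBr /= vv ve'; apply/matrixP => i j.
  by rewrite !ord1 !mxE /c /=; field.
have c0 : c != 0.
  by apply: contra ve => /eqP c0; rewrite -subr_eq0 -normsq_eq0 wwE c0 mxE mul0rn.
pose Q := 1%:M - (2 / c) *: (w^T *m w).
have Qsym : Q^T = Q by rewrite /Q linearB linearZ /= trmx1 trmx_mul trmxK.
exists Q.
  have PP : (w^T *m w) *m (w^T *m w) = c *: (w^T *m w).
    by rewrite mulmxA -(mulmxA w^T w) wwE mul_mx_scalar -scalemxAl.
  rewrite Qsym /Q mulmxBr mulmx1 mulmxBl mul1mx -scalemxAl -scalemxAr PP !scalerA.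
  rewrite -addrA -opprD -scalerBl -scalerDl.
  have -> : 2 / c + (2 / c - 2 / c * (2 / c) * c) = 0 by field.
  by rewrite scale0r subr0.
rewrite rowE -/e /Q mulmxBr mulmx1 -scalemxAr mulmxA ewE mul_scalar_mx scalerA.
have -> : 2 / c * (- (c / 2)) = -1 by field; rewrite c0.
by rewrite scaleN1r opprK /w addrC subrK.
Qed.

(** If the orthogonal [Q] has a unit eigenvector of [M] as its first row, then
    [Q M Q^T] has first row [(a, 0, ..., 0)], and by symmetry it is block
    diagonal, with a symmetric lower right block. *)
Theorem real_spectral (R : rcfType) (n : nat) (M : 'M[R]_n) : M^T = M ->
  exists (U : 'M[R]_n) (d : 'rV[R]_n),
    U *m U^T = 1%:M /\ M = U *m diag_mx d *m U^T.
Proof.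
elim: n M => [|n IHn] M Msym.
  by exists 1%:M, 0; rewrite [M]thinmx0 !thinmx0.
have [a /eigenvalueP[u uM u0]] := symmetric_eigenvalue Msym.
pose q := (u *m u^T) 0 0.
have q0 : 0 < q.
  by rewrite lt0r normsq_eq0 u0 normsq_ge0.
pose v := (Num.sqrt q)^-1 *: u.
have vv : v *m v^T = 1%:M.
  rewrite /v linearZ /= -scalemxAl -scalemxAr scalerA -invfM -expr2.
  rewrite sqr_sqrtr ?ltW //.
  by rewrite [u *m _]mx11_scalar -/q scale_scalar_mx mulVf ?gt_eqF.
have [Q QQ Qv] := householder vv.
have QQ' := mulmx1C QQ.
pose N : 'M_(1 + n) := Q *m M *m Q^T.
have NT : N^T = N by rewrite /N !trmx_mul trmxK Msym mulmxA.
have N0 : row 0 N = a *: delta_mx 0 0.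
  rewrite /N !row_mul Qv /v -scalemxAl uM scalerA mulrC -scalerA -scalemxAl -/v -Qv.
  by rewrite -row_mul QQ row1.
have NE : N = block_mx a%:M 0 0 (drsubmx N).
  have ur : ursubmx N = 0.
    apply/rowP => j; move/rowP/(_ (rshift 1 j)): N0; rewrite !mxE /= mulr0.
    by rewrite (_ : lshift n 0 = 0) //; apply: val_inj.
  rewrite -[LHS]submxK ur; congr block_mx.
    apply/matrixP => i j; rewrite !ord1; move/rowP/(_ 0): N0.
    by rewrite !mxE /= mulr1 (_ : lshift n 0 = 0) //; apply: val_inj.
  by rewrite -[dlsubmx N]trmxK trmx_dlsub NT ur trmx0.
have [V [d [VV VE]]] : exists (U : 'M[R]_n) (d : 'rV[R]_n),
    U *m U^T = 1%:M /\ drsubmx N = U *m diag_mx d *m U^T.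
  by apply: IHn; rewrite trmx_drsub NT.
pose W : 'M_(1 + n) := block_mx 1%:M 0 0 V.
have WT : W^T = block_mx 1%:M 0 0 V^T by rewrite tr_block_mx !trmx0 trmx1.
have WW : W *m W^T = 1%:M.
  rewrite WT mulmx_block !(mulmx0, mul0mx, mulmx1, addr0, add0r) VV.
  by rewrite -scalar_mx_block.
have NW : N = W *m diag_mx (row_mx a%:M d) *m W^T.
  have DE :
      diag_mx (row_mx a%:M d) = block_mx a%:M 0 0 (diag_mx d) :> 'M_(1 + n).
    rewrite diag_mx_row; congr block_mx; apply/matrixP => i j.
    by rewrite !ord1 !mxE.
  rewrite DE NE VE WT !mulmx_block.
  by rewrite !(mulmx0, mul0mx, mulmx1, mul1mx, addr0, add0r).
have MN : M = Q^T *m N *m Q by rewrite /N !mulmxA QQ' mul1mx -mulmxA QQ' mulmx1.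
exists (Q^T *m W), (row_mx a%:M d); split.
  by rewrite trmx_mul trmxK mulmxA -(mulmxA Q^T W) WW mulmx1.
by rewrite [LHS]MN NW trmx_mul trmxK !mulmxA.
Qed.

(** * Positive definite matrices *)

(** The [i]-th diagonal entry is the value of the quadratic form of [M] at the
    [i]-th column of [U]. *)
Lemma posdef_diag (R : realType) (p : nat) (M : 'M[R]_p) : posdefmx M ->
  exists (U : 'M[R]_p) (d : 'rV[R]_p),
    [/\ U *m U^T = 1%:M, M = U *m diag_mx d *m U^T & forall i, 0 < d 0 i].
Proof.
move=> [MT Mpos]; have [U [d [UU ME]]] := real_spectral MT.
exists U, d; split=> // i; have U'U := mulmx1C UU.
have : col i U != 0.
  apply: contra_eq_neq U'U => Ui; rewrite colE in Ui.
  have := congr1 (fun v => U^T *m v) Ui; rewrite mulmxA mulmx0 => E.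
  apply/eqP => U'U; move: E; rewrite U'U mul1mx => /matrixP/(_ i 0)/eqP.
  by rewrite !mxE !eqxx oner_eq0.
move=> /Mpos; rewrite ME colE trmx_mul !mulmxA -(mulmxA _ U^T U) U'U mulmx1.
rewrite -(mulmxA _ U^T U) U'U mulmx1 trmx_delta -rowE -colE.
by rewrite !mxE eqxx.
Qed.

Lemma unit_gram_posdef (R : realType) (p : nat) (L : 'M[R]_p) :
  L \in unitmx -> posdefmx (L^T *m L).
Proof.
move=> Lu; split=> [|v v0]; first by rewrite trmx_mul trmxK.
have -> : v^T *m (L^T *m L) *m v = (v^T *m L^T) *m (v^T *m L^T)^T.
  by rewrite trmx_mul !trmxK !mulmxA.
rewrite lt0r normsq_ge0 normsq_eq0 andbT; apply: contra v0 => /eqP vL.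
have /mulmxK vLK : L^T \in unitmx by rewrite unitmx_tr.
by rewrite -trmx_eq0 -(vLK _ v^T) vL mul0mx.
Qed.

Lemma posdef_congr (R : realType) (p : nat) (L S : 'M[R]_p) :
  L \in unitmx -> posdefmx S -> posdefmx (L *m S *m L^T).
Proof.
move=> Lu [ST Spos]; split=> [|v v0]; first by rewrite !trmx_mul trmxK ST mulmxA.
have -> : v^T *m (L *m S *m L^T) *m v = (L^T *m v)^T *m S *m (L^T *m v).
  by rewrite trmx_mul trmxK !mulmxA.
apply: Spos; apply: contra v0 => /eqP Lv.
have /mulKmx LK : L^T \in unitmx by rewrite unitmx_tr.
by rewrite -(LK _ v) Lv mulmx0.
Qed.

(** At [v] the quadratic form is the sum of the squared norms of [v^T B_i Q].
    It vanishes only if every [v^T B_i Q] does, which for invertible [Q] does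
    not depend on [Q]. *)
Lemma posdef_sum_mulr (R : realType) (p q k : nat) (B : 'I_k -> 'M[R]_(p, q))
    (Q : 'M[R]_q) : Q \in unitmx ->
  posdefmx (\sum_i B i *m (B i)^T) ->
  posdefmx (\sum_i (B i *m Q) *m (B i *m Q)^T).
Proof.
move=> Qu [_ Bpos]; split=> [|v /Bpos].
  by rewrite raddf_sum; apply: eq_bigr => i _; rewrite /= trmx_mul trmxK.
have E q' (C : 'I_k -> 'M[R]_(p, q')) :
    (v^T *m (\sum_i C i *m (C i)^T) *m v) 0 0 =
    \sum_i ((v^T *m C i) *m (v^T *m C i)^T) 0 0.
  rewrite mulmx_sumr mulmx_suml summxE; apply: eq_bigr => i _.
  by rewrite trmx_mul trmxK !mulmxA.
rewrite !E !lt0r => /andP[+ _].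
rewrite sumr_ge0 ?andbT => [|i _]; last exact: normsq_ge0.
apply: contra; rewrite psumr_eq0 => [/allP z|i _]; last exact: normsq_ge0.
rewrite big1 // => i _; apply/eqP; rewrite normsq_eq0.
have := z i; rewrite mem_index_enum normsq_eq0 mulmxA => /(_ isT)/eqP zi.
by rewrite -(mulmxK Qu (v^T *m B i)) zi mul0mx.
Qed.

(** * Laws of real powers *)
Lemma mxpow_orthogonal_congr (R : realType) (p : nat) (M Q : 'M[R]_p) (s : R) :
  M^T = M -> Q *m Q^T = 1%:M ->
  mxpow (Q *m M *m Q^T) s = Q *m mxpow M s *m Q^T.
Proof.
move=> /real_spectral[U [d [UU ->]]] QQ.
have QU : (Q *m U) *m (Q *m U)^T = 1%:M.
  by rewrite trmx_mul mulmxA -(mulmxA Q U) UU mulmx1.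
have E e : Q *m (U *m diag_mx e *m U^T) *m Q^T =
    (Q *m U) *m diag_mx e *m (Q *m U)^T.
  by rewrite trmx_mul !mulmxA.
by rewrite E /mxpow !mxfunE // E.
Qed.

Lemma mxpow_sym (R : realType) (p : nat) (M : 'M[R]_p) (s : R) :
  M^T = M -> (mxpow M s)^T = mxpow M s.
Proof.
move=> /real_spectral[U [d [UU ->]]]; rewrite /mxpow mxfunE //.
by rewrite !trmx_mul trmxK tr_diag_mx mulmxA.
Qed.

Lemma mxpowD (R : realType) (p : nat) (M : 'M[R]_p) (a b : R) : posdefmx M ->
  mxpow M (a + b) = mxpow M a *m mxpow M b.
Proof.
move=> /posdef_diag[U [d [UU -> d0]]]; rewrite /mxpow !mxfunE //.
rewrite !mulmxA -(mulmxA _ U^T U) (mulmx1C UU) mulmx1.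
rewrite -(mulmxA U (diag_mx _) (diag_mx _)) mulmx_diag.
congr (U *m diag_mx _ *m _); apply/rowP => i; rewrite !mxE powRD //.
by apply/implyP=> _; rewrite gt_eqF.
Qed.

Lemma mxpow0 (R : realType) (p : nat) (M : 'M[R]_p) : M^T = M ->
  mxpow M 0 = 1%:M.
Proof.
move=> /real_spectral[U [d [UU ->]]]; rewrite /mxpow mxfunE //.
rewrite (_ : map_mx _ d = const_mx 1) ?diag_const_mx ?mulmx1 //.
by apply/rowP => i; rewrite !mxE powRr0.
Qed.

Lemma mxpow1 (R : realType) (p : nat) (M : 'M[R]_p) : posdefmx M ->
  mxpow M 1 = M.
Proof.
move=> /posdef_diag[U [d [UU -> d0]]]; rewrite /mxpow mxfunE //.
congr (U *m diag_mx _ *m _); apply/rowP => i; rewrite !mxE powRr1 //.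
exact: ltW.
Qed.

Lemma mxpowNr (R : realType) (p : nat) (M : 'M[R]_p) (s : R) : posdefmx M ->
  mxpow M s *m mxpow M (- s) = 1%:M.
Proof. by move=> Mp; rewrite -mxpowD // subrr mxpow0 //; case: Mp. Qed.

Lemma mxpow_unit (R : realType) (p : nat) (M : 'M[R]_p) (s : R) : posdefmx M ->
  mxpow M s \in unitmx.
Proof. by move=> /mxpowNr-/(_ s)/mulmx1_unit[]. Qed.

Lemma posdef_unit (R : realType) (p : nat) (M : 'M[R]_p) :
  posdefmx M -> M \in unitmx.
Proof. by move=> Mp; rewrite -(mxpow1 Mp) mxpow_unit. Qed.

(** A diagonalization of [M] also diagonalizes [(c M)^-1], with the inverses of
    the [c * d_i] on the diagonal. *)
Lemma mxpow_scale_inv (R : realType) (p : nat) (M : 'M[R]_p) (c s : R) :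
  0 < c -> posdefmx M ->
  mxpow (c^-1 *: invmx M) s = c `^ (- s) *: mxpow M (- s).
Proof.
move=> c0 Mpos; have Mu := posdef_unit Mpos.
have [U [d [UU ME d0]]] := posdef_diag Mpos.
have powVE x : 0 < x -> x^-1 `^ s = x `^ (- s).
  by move=> x0; rewrite -powR_inv1 ?ltW // -powRrM mulN1r.
have -> : c^-1 *: invmx M =
    U *m diag_mx (map_mx (fun x => (c * x)^-1) d) *m U^T.
  have E :
      c *: M *m (U *m diag_mx (map_mx (fun x => (c * x)^-1) d) *m U^T) = 1%:M.
    rewrite ME -scalemxAl !mulmxA -(mulmxA _ U^T U) (mulmx1C UU) mulmx1.
    rewrite -(mulmxA U (diag_mx _) (diag_mx _)) mulmx_diag.
    rewrite scalemxAl scalemxAr -linearZ /=.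
    rewrite (_ : c *: _ = const_mx 1) ?diag_const_mx ?mulmx1 //.
    by apply/rowP => i; rewrite !mxE mulrA mulfV // mulf_neq0 ?gt_eqF.
  have cMu := (mulmx1_unit E).1.
  by rewrite -invmxZ // -[RHS](mulKmx cMu) E mulmx1.
rewrite /mxpow mxfunE // [in RHS]ME mxfunE // scalemxAl scalemxAr -linearZ /=.
congr (U *m diag_mx _ *m _); apply/rowP => i.
by rewrite !mxE powVE ?mulr_gt0 // powRM ?ltW.
Qed.

(** * Congruence invariance of the geodesic *)

(** [Q = L X^(-1/2)] is the orthogonal factor of the polar decomposition of
    [L]; it turns the inner argument of the geodesic into [Q^T Z Q], and the
    power passes through this conjugation. *)
Lemma geodesic_congr (R : realType) (p : nat) (L Z : 'M[R]_p) (w : R) :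
  L \in unitmx -> Z^T = Z ->
  geodesic (L^T *m L) w (L^T *m Z *m L) = L^T *m mxpow Z w *m L.
Proof.
move=> Lu ZT; have Xpos := unit_gram_posdef Lu.
rewrite /geodesic; set X := L^T *m L in Xpos *.
set H := mxpow X 2^-1; set K := mxpow X (- 2^-1).
have HK : H *m K = 1%:M by apply: mxpowNr.
have KH := mulmx1C HK.
have HT : H^T = H by apply: mxpow_sym; case: Xpos.
have KT : K^T = K by apply: mxpow_sym; case: Xpos.
have HH : H *m H = X.
  by rewrite -mxpowD // -[RHS]mxpow1 //; congr mxpow; field.
pose Q := L *m K.
have QT : Q^T = K *m L^T by rewrite trmx_mul KT.
have QQ : Q^T *m Q^T^T = 1%:M.
  by rewrite trmxK QT mulmxA -(mulmxA K) -/X -HH mulmxA KH mul1mx HK.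
have QH : Q *m H = L by rewrite /Q -mulmxA KH mulmx1.
have -> : K *m (L^T *m Z *m L) *m K = Q^T *m Z *m Q^T^T.
  by rewrite trmxK QT !mulmxA.
have LT : L^T = H *m Q^T by rewrite -QH trmx_mul HT.
by rewrite mxpow_orthogonal_congr // trmxK LT -[in RHS]QH !mulmxA.
Qed.

(** The invertibility of [L' L] lets the step be iterated. *)
Lemma geodesic_sor_step (R : realType) (p : nat) (L S : 'M[R]_p) (w : R)
    (L' := p%:R `^ (- (w / 2)) *: mxpow (L *m S *m L^T) (- (w / 2))) :
  L \in unitmx -> posdefmx S ->
  geodesic (L^T *m L) w (p%:R^-1 *: invmx S) = (L' *m L)^T *m (L' *m L) /\
  L' *m L \in unitmx.
Proof.
move=> Lu Spos; have Tpos := posdef_congr Lu Spos.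
(* In size 0 the scalar [p^-1] vanishes, but all matrices are equal. *)
have [p0|p_gt0] := posnP p.
  move: L S @L' Lu Spos Tpos; rewrite p0 => *.
  by split; [rewrite [LHS]flatmx0 [RHS]flatmx0 | rewrite unitmxE det_mx00 unitr1].
have c0 : 0 < p%:R :> R by rewrite ltr0n.
set T := L *m S *m L^T in L' Tpos *.
have LTu : L^T \in unitmx by rewrite unitmx_tr.
have Su := posdef_unit Spos.
split; last first.
  by rewrite unitmx_mul Lu andbT unitmxZ ?mxpow_unit // unitfE gt_eqF ?powR_gt0.
have -> : p%:R^-1 *: invmx S = L^T *m (p%:R^-1 *: invmx T) *m L.
  have TV : T *m (invmx L^T *m invmx S *m invmx L) = 1%:M.
    by rewrite /T !mulmxA mulmxK // mulmxK // mulmxV.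
  have -> : invmx T = invmx L^T *m invmx S *m invmx L.
    by rewrite -[RHS](mulKmx (posdef_unit Tpos)) TV mulmx1.
  by rewrite -scalemxAr -scalemxAl !mulmxA mulmxV // mul1mx mulmxKV.
have TT : T^T = T by case: Tpos.
rewrite geodesic_congr ?linearZ /= ?trmx_inv ?TT //.
rewrite mxpow_scale_inv // trmx_mul /L' [(_ *: _)^T]linearZ /= mxpow_sym //.
have -> : - w = - (w / 2) + - (w / 2) by field.
rewrite mxpowD // powRD; last by apply/implyP=> _; rewrite gt_eqF.
by rewrite -!scalemxAl -!scalemxAr -!scalemxAl scalerA !mulmxA.
Qed.

(** * Equivalence of the two algorithms *)
Theorem proposition2p4 (R : realType) (m n k : nat)
    (A : 'I_k -> 'M[R]_(m, n)) (omega : R)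
    (hAAt : posdefmx (\sum_(i < k) A i *m (A i)^T))
    (hAtA : posdefmx (\sum_(i < k) (A i)^T *m A i))
    (homega : 0 < omega)
    (X : nat -> 'M[R]_m) (Y : nat -> 'M[R]_n)
    (hXY : FPI_Geodesic_SOR A 1%:M 1%:M omega X Y)
    (barL : nat -> 'M[R]_m) (barR : nat -> 'M[R]_n)
    (barA : nat -> 'I_k -> 'M[R]_(m, n))
    (hbar : OSI_Geodesic_SOR A omega barL barR barA)
    (L : nat -> 'M[R]_m) (Rt : nat -> 'M[R]_n)
    (hL0 : L 0%N = 1%:M) (hR0 : Rt 0%N = 1%:M)
    (hL : forall t : nat, L t.+1 = barL t.+1 *m L t)
    (hR : forall t : nat, Rt t.+1 = barR t.+1 *m Rt t) :
  forall t : nat,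
    (forall i : 'I_k, barA t i = L t *m A i *m (Rt t)^T) /\
    X t = (L t)^T *m L t /\
    Y t = (Rt t)^T *m Rt t.
Proof.
case: hXY => X0 Y0 hX hY; case: hbar => A0 hbL hbR hbA t.
suff [] : [/\ L t \in unitmx, Rt t \in unitmx,
    forall i : 'I_k, barA t i = L t *m A i *m (Rt t)^T,
    X t = (L t)^T *m L t & Y t = (Rt t)^T *m Rt t] by [].
elim: t => [|t [Lu Ru AE XE YE]].
  rewrite hL0 hR0 X0 Y0 !unitmx1 !trmx1 !mulmx1; split=> // i.
  by rewrite A0 mul1mx mulmx1.
have SL : posdefmx (\sum_i A i *m Y t *m (A i)^T).
  have := posdef_sum_mulr (Q := (Rt t)^T) _ hAAt; rewrite unitmx_tr => /(_ Ru).
  by congr posdefmx; apply: eq_bigr => i _; rewrite YE trmx_mul trmxK !mulmxA.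
have barLE : barL t.+1 = m%:R `^ (- (omega / 2)) *:
    mxpow (L t *m (\sum_i A i *m Y t *m (A i)^T) *m (L t)^T) (- (omega / 2)).
  rewrite hbL; congr (_ *: mxpow _ _); rewrite mulmx_sumr mulmx_suml.
  by apply: eq_bigr => i _; rewrite AE YE !trmx_mul trmxK !mulmxA.
have [] := geodesic_sor_step omega Lu SL.
rewrite -XE -hX -barLE -hL => XE' Lu'.
have SR : posdefmx (\sum_i (A i)^T *m X t.+1 *m A i).
  have := @posdef_sum_mulr _ _ _ _ (fun i => (A i)^T) (L t.+1)^T.
  rewrite unitmx_tr => /(_ Lu').
  under eq_bigr => i _ do rewrite trmxK.
  move=> /(_ hAtA); congr posdefmx; apply: eq_bigr => i _.
  by rewrite XE' trmx_mul !trmxK !mulmxA.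
have barRE : barR t.+1 = n%:R `^ (- (omega / 2)) *:
    mxpow (Rt t *m (\sum_i (A i)^T *m X t.+1 *m A i) *m (Rt t)^T)
      (- (omega / 2)).
  rewrite hbR; congr (_ *: mxpow _ _); rewrite mulmx_sumr mulmx_suml.
  by apply: eq_bigr => i _; rewrite AE XE' hL !trmx_mul trmxK !mulmxA.
have [] := geodesic_sor_step omega Ru SR.
rewrite -YE -hY -barRE -hR => YE' Ru'.
split=> // i.
by rewrite hbA AE hL hR trmx_mul !mulmxA.
Qed.
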